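(* Let $(X,\mathcal F,T,P)$ be any target problem, let $\mathrm{Str}=(\mathrm{Str}_n)_n$ be any target algorithm, and write $(X,\mathcal F_n,T,P_n)=\mathrm{Str}_n(X,\mathcal F,T,P)$. Then $\lim_{n\to\infty} d(P,P_n)=0$.
   Context: Standing setting. $(X,\mathcal X)$ is a measurable space and $T\in\mathcal X$ is a fixed set (the target). A random variable is a measurable $f:(X,\mathcal X)\to(\mathbb R,\mathcal B_{\mathbb R})$; it is discrete if it takes at most countably many values. $\pi_f$ is the equivalence relation $x\,\pi_f\,y\iff f(x)=f(y)$. Relations are ordered by inclusion as subsets of $X\times X$. It is assumed throughout that $(X,\mathcal X)$ satisfies (A0): for all random variables $f,g$, $\pi_f\subseteq\pi_g$ implies $\sigma(f)\supseteq\sigma(g)$. An equivalence relation on a measurable space is measurable (discrete) if it equals $\pi_f$ for some (discrete) random variable $f$ on that space. Target problems. For a sub-$\sigma$-algebra $\mathcal F\subseteq\mathcal X$ with $T\in\mathcal F$, a transition probability on $(X,\mathcal F)$ is $P:X\times\mathcal F\to[0,1]$ with $P(x,\cdot)$ a probability measure on $\mathcal F$ for every $x\in X$ and $P(\cdot,F)$ $\mathcal F$-measurable for every $F\in\mathcal F$. Set $P^1=P$, $P^{n+1}(x,F)=\int_X P(x,dy)P^n(y,F)$. A target problem is $(X,\mathcal F,T,P)$ with such $\mathcal F,P$; it is simple if $\mathcal F$ is generated by an at most countable partition of $X$. A strategy is a sequence $(\mathrm{Str}_n)_n$ of maps from target problems to simple target problems. Pseudometric. Fix $\beta\in(0,1)$.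 For transition probabilities $P_1,P_2$ (possibly on different sub-$\sigma$-algebras containing $T$), $d(P_1,P_2)=\sup_{x\in X}\sum_{n\ge1}\beta^n|P_1^n(x,T)-P_2^n(x,T)|$. Target algorithms. Let $S=\{p=(p_i)_{i\ge1}: p_i\ge0,\ \sum_i p_i\le1\}\subset\ell_1$ with the $\sigma$-algebra $\mathcal B_S$ induced by the product Borel $\sigma$-algebra of $[0,1]^{\mathbb N}$. An $\epsilon$-equivalence on $S$ is a discrete equivalence $\sim_\epsilon$ on $(S,\mathcal B_S)$ such that $\|p-q\|_1<\epsilon$ whenever $p\sim_\epsilon q$. A target algorithm is a strategy obtained as follows. Choose $\epsilon_n>0$, $\epsilon_n\to0$, and for each $n$ an $\epsilon_n$-equivalence $\sim_{\epsilon_n}$ on $S$. Given $(X,\mathcal F,T,P)$, let $\mathcal F_0=\sigma(T)=\{\varnothing,T,X\setminus T,X\}$ with $\pi_0$ the equivalence with classes $T$, $X\setminus T$. For $n\ge1$, let $(A_i^{(n-1)})_i$ be an enumeration of the at most countable partition $X/\pi_{n-1}$ generating $\mathcal F_{n-1}$, and set $x\,\pi_n\,y\iff x\,\pi_{n-1}\,y$ and $(P(x,A_i^{(n-1)}))_i\sim_{\epsilon_n}(P(y,A_i^{(n-1)}))_i$ (finite sequences are extended by zeros), $\mathcal F_n=\sigma(X/\pi_n)$. Choose a probability measure $\mu$ on $\vee_n\mathcal F_n$ with $\mu(F)>0$ for every $n$ and every nonempty $F\in\mathcal F_n$ (such $\mu$ exists). For $F\in\mathcal F_n$ put $Y^F(\omega)=P(\omega,F)$,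 which is a $\vee_n\mathcal F_n$-measurable random variable, and $P_n(x,F)=\mathbb E_\mu[Y^F\mid\mathcal F_n](x)$ for all $x\in X$, i.e. $P_n(x,F)=\mu([x]_n)^{-1}\int_{[x]_n}P(z,F)\,\mu(dz)$ with $[x]_n$ the $\pi_n$-class of $x$. Then $\mathrm{Str}_n(X,\mathcal F,T,P)=(X,\mathcal F_n,T,P_n)$. *)

(* Defs.v *)
From HB Require Import structures.
From mathcomp Require Import all_boot all_order all_algebra.
From mathcomp Require Import all_classical all_reals all_analysis.

Set Implicit Arguments.
Unset Strict Implicit.
Unset Printing Implicit Defensive.

Import Order.TTheory GRing.Theory Num.Theory.
Import numFieldNormedType.Exports.

Local Open Scope classical_set_scope.
Local Open Scope ring_scope.
Local Open Scope ereal_scope.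

Section equivalences.

Definition ker_rel (X Y : Type) (f : X -> Y) : X -> X -> Prop :=
  fun x y => f x = f y.

Definition rel_class (X : Type) (r : X -> X -> Prop) (x : X) : set X :=
  [set y | r x y].

Definition rel_quotient (X : Type) (r : X -> X -> Prop) : set (set X) :=
  range (rel_class r).

Definition discrete_equivalence (d : measure_display) (X : measurableType d)
    (R : realType) (r : X -> X -> Prop) : Prop :=
  exists f : {mfun X >-> R},
    countable (range f) /\ forall x y, r x y <-> ker_rel f x y.

Definition assumption_A0 (d : measure_display) (X : measurableType d)
    (R : realType) : Prop :=
  forall f g : {mfun X >-> R},
    (forall x y, ker_rel f x y -> ker_rel g x y) ->
    g_sigma_algebra_preimage g `<=` g_sigma_algebra_preimage f.

(* An enumeration (A_i)_i of the family C of nonempty sets, without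
   repetition; when C is finite, A is continued by empty sets, so that
   (m (A_i))_i is continued by zeros for every measure m. *)
Definition enumerates (X : Type) (A : nat -> set X) (C : set (set X)) : Prop :=
  set_bij [set i | A i !=set0] C A /\
  (forall i j, (i <= j)%N -> A i = set0 -> A j = set0).

End equivalences.

Arguments discrete_equivalence {d X} R r.

Section subprobability_sequences.
Variable R : realType.

Record subprob_seq := SubprobSeq {
  sval_seq :> nat -> R;
  subprob_seq_ge0 : forall i, (0 <= sval_seq i)%R;
  subprob_seq_le1 : \sum_(0 <= i <oo) (sval_seq i)%:E <= 1 }.

Lemma zero_seq_le1 : \sum_(0 <= i <oo) ((fun=> 0%R) i : R)%:E <= 1.
Proof. by rewrite eseries0. Qed.

HB.instance Definition _ := gen_eqMixin subprob_seq.
HB.instance Definition _ := gen_choiceMixin subprob_seq.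
HB.instance Definition _ := isPointed.Build subprob_seq
  (@SubprobSeq (fun=> 0%R) (fun=> lexx 0%R) zero_seq_le1).

Definition cylinders : set (set (nat -> R)) :=
  \bigcup_(i : nat)
    preimage_set_system setT (fun u : nat -> R => u i) measurable.

(* The sequences with values in [0,1] carry the trace of the product Borel
   sigma-algebra of R^nat, so both ambient spaces induce the same
   sigma-algebra on the space of subprobability sequences. *)
Local Notation subprob_space :=
  (@g_sigma_algebra_preimageType _ subprob_seq (g_sigma_algebraType cylinders)
    sval_seq).

Definition l1_dist (p q : subprob_seq) : \bar R :=
  \sum_(0 <= i <oo) `|p i - q i|%:E.

Definition eps_equivalence (eps : R)
    (r : subprob_space -> subprob_space -> Prop) : Prop :=
  discrete_equivalence R r /\ forall p q, r p q -> l1_dist p q < eps%:E.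

End subprobability_sequences.

Notation subprob_space R :=
  (@g_sigma_algebra_preimageType _ (subprob_seq R)
    (g_sigma_algebraType (@cylinders R)) (@sval_seq R)).

Section target_problems.
Context {d : measure_display} {X : measurableType d} (R : realType)
        (T : set X).

Record target_problem := TargetProblem {
  tp_sigma : set (set X);
  tp_sigma_algebra : sigma_algebra setT tp_sigma;
  tp_sigma_measurable : tp_sigma `<=` measurable;
  tp_target : tp_sigma T;
  tp_kernel :> R.-pker (g_sigma_algebraType tp_sigma) ~>
                       (g_sigma_algebraType tp_sigma) }.

Definition is_simple (tp : target_problem) : Prop :=
  exists D : set (set X),
    [/\ countable D, partition D id setT & tp_sigma tp = <<s D >>].

Record simple_target_problem := SimpleTargetProblem {
  stp_problem :> target_problem;
  stp_simple : is_simple stp_problem }.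

Definition strategy := nat -> target_problem -> simple_target_problem.

End target_problems.

Section pseudometric.
Context {d : measure_display} {X : measurableType d} {R : realType}.

(* Meaningful for n >= 1, with kernel_power P 1 = P. *)
Definition kernel_power (F : set (set X))
    (P : R.-pker (g_sigma_algebraType F) ~> (g_sigma_algebraType F))
    (n : nat) : X -> set X -> \bar R :=
  iter n.-1 (fun K x A => \int[P x]_y K y A) (fun x A => P x A).

Definition kernel_dist (T : set X) (beta : R) (F1 F2 : set (set X))
    (P1 : R.-pker (g_sigma_algebraType F1) ~> (g_sigma_algebraType F1))
    (P2 : R.-pker (g_sigma_algebraType F2) ~> (g_sigma_algebraType F2)) :
    \bar R :=
  ereal_sup (range (fun x : X =>
    \sum_(1 <= n <oo)
      (beta ^+ n)%:E * `|kernel_power P1 n x T - kernel_power P2 n x T|)).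

End pseudometric.

Section target_algorithms.
Context {d : measure_display} {X : measurableType d} {R : realType}
        {T : set X}.

Definition level_sigma (pi : nat -> X -> X -> Prop) (n : nat) : set (set X) :=
  if n is 0%N then <<s [set T] >> else <<s rel_quotient (pi n) >>.

Local Notation limit_space pi :=
  (g_sigma_algebraType (\bigcup_n level_sigma pi n)).

(* [p n x] is the sequence (P(x, A_i^(n)))_i, as an element of the space of
   subprobability sequences. *)
Definition refinement (eqv : nat -> subprob_space R -> subprob_space R -> Prop)
    (tp : target_problem R T) (pi : nat -> X -> X -> Prop)
    (A : nat -> nat -> set X) (p : nat -> X -> subprob_seq R) : Prop :=
  [/\ forall x y, pi 0%N x y <-> (T x <-> T y),
      forall n, enumerates (A n) (rel_quotient (pi n)),
      forall n x i, (p n x i)%:E = tp x (A n i) &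
      forall n x y,
        pi n.+1 x y <-> pi n x y /\ eqv n.+1 (p n x) (p n y)].

(* E_mu[Y | F_n](x), when the class of x under [pi n] has positive
   measure. *)
Definition class_expectation (pi : nat -> X -> X -> Prop)
    (mu : probability (limit_space pi) R) (Y : X -> \bar R) (n : nat)
    (x : X) : \bar R :=
  (fine (mu (rel_class (pi n) x)))^-1%:E *
  \int[mu]_(z in rel_class (pi n) x) Y z.

Definition algorithm_output
    (eqv : nat -> subprob_space R -> subprob_space R -> Prop)
    (tp : target_problem R T) (out : nat -> target_problem R T) : Prop :=
  exists (pi : nat -> X -> X -> Prop) (A : nat -> nat -> set X)
         (p : nat -> X -> subprob_seq R) (mu : probability (limit_space pi) R),
    [/\ refinement eqv tp pi A p,
        forall n F, level_sigma pi n F -> F !=set0 -> 0 < mu F,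
        forall n, tp_sigma (out n) = level_sigma pi n &
        forall n x F, level_sigma pi n F ->
          out n x F = class_expectation mu (fun z => tp z F) n x].

Definition target_algorithm (Str : strategy R T) : Prop :=
  exists (eps : nat -> R)
         (eqv : nat -> subprob_space R -> subprob_space R -> Prop),
    [/\ forall n, (0 < n)%N -> (0 < eps n)%R,
        eps n @[n --> \oo] --> 0%R,
        forall n, (0 < n)%N -> eps_equivalence (eps n) (eqv n) &
        forall tp, algorithm_output eqv tp (fun n => Str n tp)].

End target_algorithms.

(* Main.v *)
Require Import Defs.
From mathcomp Require Import all_boot all_order all_algebra.
From mathcomp Require Import all_classical all_reals all_analysis.
From mathcomp Require Import measurable_realfun lra.

Set Implicit Arguments.
Unset Strict Implicit.
Unset Printing Implicit Defensive.

Import Order.TTheory GRing.Theory Num.Theory.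
Import numFieldNormedType.Exports.

Local Open Scope classical_set_scope.
Local Open Scope ring_scope.

(* Call a set n-saturated when it is a union of classes of pi_n.  If x and y
   are pi_(n+1)-equivalent, then P(x, G) and P(y, G) differ by at most
   eps_(n+1) for every n-saturated G, uniformly in G; averaging over a class,
   so do P_(n+1)(x, G) and P(x, G).  By induction on k, the oscillation of
   P^k(., T) on the classes of pi_m vanishes as m grows: P^k(., T) is a uniform
   limit of means (1_(G_0) + ... + 1_(G_N)) / (N + 1) of indicators of
   m-saturated sets, and the integrals of such a mean against P(x, .), P(y, .)
   and P_n(x, .) are compared set by set, however many classes there are.  The
   same approximation gives sup_x |P_n^k(x, T) - P^k(x, T)| --> 0 for each k by
   induction on k, and the weights beta^k make the tail of the series small. *)

(** * Integrals against a probability measure *)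

Section integral_bounds.
Context {d : measure_display} {T : measurableType d} {R : realType}.
Variable mu : {measure set T -> \bar R}.

(** The integral of a nonnegative function is the supremum of the integrals of the simple functions
    below it, and this family grows with the function. The argument covers arbitrary nonnegative
    functions, measurable or not. *)
Lemma le_integral_nonneg (D : set T) (f g : T -> \bar R) :
  (forall x, D x -> 0 <= f x)%E -> (forall x, D x -> f x <= g x)%E ->
  (\int[mu]_(x in D) f x <= \int[mu]_(x in D) g x)%E.
Proof.
move=> f0 fg; rewrite !(integral_mkcond D).
have f0' x : (0 <= (f \_ D) x)%E by apply: erestrict_ge0.
have fg' x : ((f \_ D) x <= (g \_ D) x)%E by apply: lee_restrict.
rewrite !ge0_integralTE//; last by move=> x; exact: le_trans (fg' x).
apply: ereal_sup_le => _ [h hf <-]; exists h => // x.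
exact: le_trans (hf x) (fg' x).
Qed.

Hypothesis mu1 : (mu setT = 1)%E.

Lemma integral_in01 (f : T -> \bar R) :
  (forall x, 0 <= f x <= 1)%E -> (0 <= \int[mu]_x f x <= 1)%E.
Proof.
move=> f01; apply/andP; split.
  by apply: integral_ge0 => x _; case/andP: (f01 x).
rewrite -mu1 -[X in (_ <= X)%E]mul1e -integral_cst//.
by apply: le_integral_nonneg => x _; case/andP: (f01 x).
Qed.

Lemma in01_fin_num (a : \bar R) : (0 <= a <= 1)%E -> a \is a fin_num.
Proof.
by case/andP=> a0 a1; rewrite ge0_fin_numE// (le_lt_trans a1)// ltry.
Qed.

Lemma fine_in01 (a : \bar R) : (0 <= a <= 1)%E -> 0 <= fine a <= 1.
Proof. by move=> a01; rewrite -!lee_fin fineK ?in01_fin_num. Qed.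

Lemma measure_in01 (G : set T) : measurable G -> (0 <= mu G <= 1)%E.
Proof.
by move=> mG; rewrite measure_ge0 -mu1 le_measure ?inE.
Qed.

Lemma integral_step (N : nat) (G : nat -> set T) :
  (forall j, measurable (G j)) ->
  (\int[mu]_x (N.+1%:R^-1 * \sum_(j < N.+1) \1_(G j) x)%:E)%E =
  (N.+1%:R^-1 * \sum_(j < N.+1) fine (mu (G j)))%:E.
Proof.
move=> mG.
have N0 : 0 <= N.+1%:R^-1 :> R by rewrite invr_ge0.
under eq_integral do rewrite mulr_sumr -sumEFin.
rewrite ge0_integral_sum//; last first.
  by move=> j; apply/measurable_EFinP; apply: measurable_funM.
rewrite mulr_sumr -sumEFin; apply: eq_bigr => j _.
under eq_integral do rewrite EFinM.
rewrite ge0_integralZl//; last first.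
  by apply/measurable_EFinP; exact: measurable_indic.
rewrite integral_indic// setIT EFinM fineK//.
exact/in01_fin_num/measure_in01.
Qed.

Lemma integral_step_dist (f : T -> \bar R) (N : nat) (G : nat -> set T)
    (e : R) :
  measurable_fun setT f -> (forall x, 0 <= f x <= 1)%E ->
  (forall j, measurable (G j)) ->
  (forall x,
    `|fine (f x) - N.+1%:R^-1 * \sum_(j < N.+1) \1_(G j) x| <= e) ->
  `|fine (\int[mu]_x f x)%E - N.+1%:R^-1 * \sum_(j < N.+1) fine (mu (G j))|
    <= e.
Proof.
move=> mf f01 mG fe.
have N0 : 0 <= N.+1%:R^-1 :> R by rewrite invr_ge0.
have e0 : 0 <= e by apply: le_trans (fe point).
pose g x : R := N.+1%:R^-1 * \sum_(j < N.+1) \1_(G j) x.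
have {}fe x : `|fine (f x) - g x| <= e := fe x.
have g0 x : 0 <= g x by rewrite mulr_ge0// sumr_ge0.
have mg : measurable_fun setT (EFin \o g).
  apply/measurable_EFinP; apply: measurable_funM => //.
  by apply: measurable_sum => j; exact: measurable_indic.
have fE x : f x = (fine (f x))%:E by rewrite fineK// in01_fin_num.
have intE : (\int[mu]_x e%:E = e%:E)%E by rewrite integral_cst// mu1 mule1.
have intf : (\int[mu]_x f x)%E = (fine (\int[mu]_x f x)%E)%:E.
  by rewrite fineK// in01_fin_num// integral_in01.
(* The two bounds are integrated in the forms [f <= g + e] and [g <= f + e], in which every
   integrand is nonnegative. *)
rewrite ler_distlC -!lee_fin; apply/andP; split.
- rewrite EFinB leeBlDr// -intf -[in leRHS]intE -integral_step//.
  rewrite -ge0_integralD//; last by move=> x _; rewrite lee_fin; exact: g0.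
  apply: le_integral_nonneg => x _; first by case/andP: (f01 x).
  rewrite -/(g x) fE -EFinD lee_fin.
  by have := fe x; rewrite ler_distlC; lra.
- rewrite EFinD -intf -[in leRHS]intE -integral_step// -ge0_integralD//.
    apply: le_integral_nonneg => x _; first by rewrite lee_fin; exact: g0.
    rewrite -/(g x) fE -EFinD lee_fin.
    by have := fe x; rewrite ler_distlC; lra.
  by move=> x _; case/andP: (f01 x).
Qed.

End integral_bounds.

(** * The partitions into classes of [pi n] and their saturated sets *)

Definition saturated {X : Type} (r : X -> X -> Prop) (F : set X) : Prop :=
  forall x y, r x y -> F x -> F y.

Section refinement_theory.
Context {d : measure_display} {X : measurableType d} {R : realType}
        {T : set X}.
Variables (tp : target_problem R T) (eps : nat -> R)
  (eqv : nat -> subprob_space R -> subprob_space R -> Prop)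
  (pi : nat -> X -> X -> Prop) (A : nat -> nat -> set X)
  (p : nat -> X -> subprob_seq R).
Hypothesis eqv_eps : forall n, (0 < n)%N -> eps_equivalence (eps n) (eqv n).
Hypothesis ref : refinement eqv tp pi A p.

Local Notation F := (tp_sigma tp).
Local Notation TX := (g_sigma_algebraType F).

Let pi0E x y : pi 0 x y <-> (T x <-> T y).
Proof. by case: ref. Qed.

Let piSE n x y : pi n.+1 x y <-> pi n x y /\ eqv n.+1 (p n x) (p n y).
Proof. by case: ref. Qed.

Let enumA n : enumerates (A n) (rel_quotient (pi n)).
Proof. by case: ref. Qed.

Let pE n x i : ((p n x i)%:E = tp x (A n i))%E.
Proof. by case: ref. Qed.

(** Each [eqv n.+1] is the kernel of a random variable, hence an equivalence; the properties of [pi]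
    follow by induction on the level. *)
Lemma partition_refl n x : pi n x x.
Proof.
elim: n => [|n IH]; first by apply/pi0E.
apply/piSE; split=> //; have [[f [_ fE]] _] := @eqv_eps n.+1 isT.
exact/fE.
Qed.

Lemma partition_sym n x y : pi n x y -> pi n y x.
Proof.
elim: n => [|n IH]; first by move/pi0E => Txy; apply/pi0E; tauto.
move/piSE => [/IH pyx pxy]; apply/piSE; split=> //.
have [[f [_ fE]] _] := @eqv_eps n.+1 isT.
by apply/fE; move/fE : pxy; rewrite /ker_rel => ->.
Qed.

Lemma partition_trans n x y z : pi n x y -> pi n y z -> pi n x z.
Proof.
elim: n => [|n IH]; first by move=> /pi0E ? /pi0E ?; apply/pi0E; tauto.
move=> /piSE [xy exy] /piSE [yz eyz]; apply/piSE; split; first exact: IH yz.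
have [[f [_ fE]] _] := @eqv_eps n.+1 isT.
by apply/fE; move/fE : exy; move/fE : eyz; rewrite /ker_rel => <- ->.
Qed.

Lemma partition_le m n x y : (m <= n)%N -> pi n x y -> pi m x y.
Proof.
elim: n => [|n IH]; first by rewrite leqn0 => /eqP ->.
by rewrite leq_eqVlt => /predU1P[->//|mn] /piSE [/(IH mn)].
Qed.

Lemma saturated_le m n G :
  (m <= n)%N -> saturated (pi m) G -> saturated (pi n) G.
Proof. by move=> mn sG x y /(partition_le mn)/sG. Qed.

Lemma saturated_target n : saturated (pi n) T.
Proof. by apply: (@saturated_le 0) => // x y /pi0E xy /xy. Qed.

Lemma saturated_class n x : saturated (pi n) (rel_class (pi n) x).
Proof. by move=> y z yz xy; exact: partition_trans xy yz. Qed.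

Lemma partition_cell n i x : A n i x -> A n i = rel_class (pi n) x.
Proof.
move=> Ax; have [[fA _ _] _] := enumA n.
have [|y _ yE] := fA i; first by exists x.
rewrite -yE; have yx : pi n y x by move: Ax; rewrite -yE.
apply/seteqP; split => z /= ?; last exact: partition_trans yx _.
exact: partition_trans (partition_sym yx) _.
Qed.

Lemma partition_cellP n x : exists i, A n i x.
Proof.
have [[_ _ sA] _] := enumA n.
have [|i _ Ai] := sA (rel_class (pi n) x); first by exists x.
by exists i; rewrite Ai; exact: partition_refl.
Qed.

Lemma trivIset_cells n : trivIset setT (A n).
Proof.
have [[_ iA _] _] := enumA n.
apply/trivIsetP => i j _ _ /eqP ij; apply/seteqP; split=> // x [Ai Aj].
apply: ij; apply: iA; rewrite ?inE /=; [by exists x|by exists x|].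
by rewrite (partition_cell Ai) (partition_cell Aj).
Qed.

Lemma saturated_cell n G i : saturated (pi n) G ->
  A n i `&` G = A n i \/ A n i `&` G = set0.
Proof.
move=> sG; have [->|/set0P[x [Ax Gx]]] := eqVneq (A n i `&` G) set0.
  by right.
left; apply/setIidPl; rewrite (partition_cell Ax) => y xy; exact: sG xy Gx.
Qed.

Lemma saturated_bigcup n G : saturated (pi n) G ->
  G = \bigcup_i (A n i `&` G).
Proof.
move=> sG; apply/seteqP; split=> [x Gx|x [i _ []]//].
by have [i Ai] := partition_cellP n x; exists i.
Qed.

(** A saturated set meets each of the countably many cells in the whole cell or not at all, so it is
    a countable union of classes. *)
Lemma sigma_algebra_saturated n (S : set (set X)) G : sigma_algebra setT S ->
  (forall x, S (rel_class (pi n) x)) -> saturated (pi n) G -> S G.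
Proof.
move=> [S0 _ Sbig] Sc sG; rewrite (saturated_bigcup sG); apply: Sbig => i.
have [->|->//] := saturated_cell i sG.
by have [->|/set0P[x /partition_cell ->]] := eqVneq (A n i) set0.
Qed.

Lemma class0E x :
  rel_class (pi 0) x = T \/ rel_class (pi 0) x = ~` T.
Proof.
have [Tx|nTx] := pselect (T x); [left|right];
  by apply/seteqP; split => y /=; rewrite /rel_class /= pi0E; tauto.
Qed.

Lemma level_sigma_saturated n G :
  saturated (pi n) G -> level_sigma (T := T) pi n G.
Proof.
case: n => [|n].
  apply: sigma_algebra_saturated; first exact: smallest_sigma_algebra.
  move=> x; have sT : <<s [set T]>> T by apply: sub_sigma_algebra.
  by case: (class0E x) => ->//; rewrite -setTD; apply: sigma_algebraCD.
apply: sigma_algebra_saturated; first exact: smallest_sigma_algebra.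
by move=> x; apply: sub_sigma_algebra; exists x.
Qed.

Lemma measurable_class n x :
  measurable (rel_class (pi n) x : set TX).
Proof.
elim: n x => [|n IH] x.
  have mT : measurable (T : set TX).
    by apply: sub_sigma_algebra; exact: tp_target.
  by case: (class0E x) => ->//; exact: measurableC.
have mA i : measurable (A n i : set TX).
  by have [->|/set0P[y /partition_cell ->]] := eqVneq (A n i) set0.
have [[f [_ fE]] _] := @eqv_eps n.+1 isT.
(* On a cylinder only one coordinate [P(y, A_i)] matters, and it is measurable in y because the cell
   [A_i] is measurable at level n. *)
have mp : @measurable_fun _ _ TX (g_sigma_algebraType (@cylinders R)) setT
    (fun y => sval_seq (p n y)).
  apply: (@measurability _ _ TX (g_sigma_algebraType (@cylinders R)) _ _
    (@cylinders R)) => //.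
  move=> _ [_ [i _ [B mB <-]] <-].
  rewrite setTI setTI -comp_preimage.
  rewrite (_ : _ \o _ = (fun y => fine (tp y (A n i)))); last first.
    by apply/funext => y /=; rewrite -pE.
  rewrite -[X in measurable X]setTI.
  have mtp := measurable_kernel tp _ (mA i).
  exact: (measurableT_comp (@fine_measurable R setT measurableT) mtp).
(* The sigma-algebra on [subprob_seq R] is pulled back along [sval_seq], so the fibre of [f] is the
   trace of a measurable set [B] of sequences. *)
have [B mB BE] : measurable (f @^-1` [set f (p n x)]).
  exact: measurable_funPTI.
rewrite (_ : rel_class _ x =
  rel_class (pi n) x `&` ((fun y => sval_seq (p n y)) @^-1` B)).
  apply: measurableI; first exact: IH.
  by rewrite -[X in measurable X]setTI; apply: mp.
have BE' q : B (sval_seq q) <-> f q = f (p n x).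
  by have /seteqP[h1 h2] := BE; split=> [Bq|fq]; [apply: h1|case: (h2 q)].
apply/seteqP; split=> y /=; rewrite /rel_class /= piSE fE /ker_rel BE'.
  by case=> ? ->.
by case=> ? ->.
Qed.

Lemma measurable_saturated n G : saturated (pi n) G ->
  measurable (G : set TX).
Proof.
apply: sigma_algebra_saturated; last exact: measurable_class.
exact: smallest_sigma_algebra.
Qed.

End refinement_theory.

(** * Comparison of [P] on equivalent points, and of [P] with its class averages *)

Section closeness.
Context {d : measure_display} {X : measurableType d} {R : realType}
        {T : set X}.
Variables (tp : target_problem R T) (eps : nat -> R)
  (eqv : nat -> subprob_space R -> subprob_space R -> Prop)
  (pi : nat -> X -> X -> Prop) (A : nat -> nat -> set X)
  (p : nat -> X -> subprob_seq R).
Hypothesis eqv_eps : forall n, (0 < n)%N -> eps_equivalence (eps n) (eqv n).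
Hypothesis ref : refinement eqv tp pi A p.

Local Notation TX := (g_sigma_algebraType (tp_sigma tp)).

(** By countable additivity over the cells contained in G, the difference is at most the sum of all
    [|P(x, A_i) - P(y, A_i)|]. That is the l1 distance controlled by [eqv n.+1], whatever G is. *)
Lemma kernel_le_add_eps n x y (G : set X) :
  pi n.+1 x y -> saturated (pi n) G -> (tp x G <= tp y G + (eps n.+1)%:E)%E.
Proof.
move=> xy sG; have [_ _ pE piSE] := ref.
have mG i : measurable (A n i `&` G : set TX).
  have [->|->] := saturated_cell eqv_eps ref i sG; last by [].
  have [->|/set0P[z /(partition_cell eqv_eps ref) ->]] := eqVneq (A n i) set0.
    by [].
  exact: (measurable_class eqv_eps ref).
have tG : trivIset setT (fun i => A n i `&` G).
  apply: trivIset_setIr; exact: (trivIset_cells eqv_eps ref).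
have tpE z : (tp z G = \sum_(0 <= i <oo) tp z (A n i `&` G))%E.
  rewrite {1}(saturated_bigcup eqv_eps ref sG).
  rewrite (@measure_semi_bigcup _ _ _ (tp z) (fun i => A n i `&` G))//.
  exact: bigcupT_measurable.
rewrite !tpE.
apply: (@le_trans _ _ (\sum_(0 <= i <oo)
    (tp y (A n i `&` G) + `|p n x i - p n y i|%:E))%E).
  apply: lee_nneseries => [i _ _|i _]; first exact: measure_ge0.
  have [->|->] := saturated_cell eqv_eps ref i sG.
    by rewrite -!pE -EFinD lee_fin -lerBlDl ler_norm.
  by rewrite !measure0 add0e lee_fin.
rewrite nneseriesD//.
rewrite leeD2l//; apply: ltW.
have /piSE[_ exy] := xy; have [_ l1] := @eqv_eps n.+1 isT.
exact: l1 exy.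
Qed.

Lemma kernel_fin_num x (G : set X) : measurable (G : set TX) ->
  tp x G \is a fin_num.
Proof.
by move=> mG; apply/in01_fin_num/measure_in01 => //; exact: prob_kernel.
Qed.

Lemma kernel_dist_eps n x y (G : set X) :
  pi n.+1 x y -> saturated (pi n) G ->
  `|fine (tp x G) - fine (tp y G)| <= eps n.+1.
Proof.
move=> xy sG; have mG := measurable_saturated eqv_eps ref sG.
rewrite ler_distlC -!lee_fin EFinB EFinD leeBlDr// !fineK ?kernel_fin_num//.
by rewrite !kernel_le_add_eps//; exact: (partition_sym eqv_eps ref).
Qed.

Local Notation limit_space :=
  (g_sigma_algebraType (\bigcup_n level_sigma (T := T) pi n)).
Variable mu : probability limit_space R.
Hypothesis mu_gt0 : forall n F,
  level_sigma (T := T) pi n F -> F !=set0 -> (0 < mu F)%E.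

(** A class has positive [mu]-measure, so the expectation is a true average, and an average of
    values within e of c is within e of c. *)
Lemma class_expectation_dist n x (Y : X -> \bar R) (c e : R) :
  (forall z, 0 <= Y z <= 1)%E ->
  (forall z, pi n x z -> `|fine (Y z) - c| <= e) ->
  `|fine (class_expectation mu Y n x) - c| <= e.
Proof.
move=> Y01 Yce.
set C := rel_class (pi n) x.
have lC : level_sigma (T := T) pi n C.
  exact/(level_sigma_saturated eqv_eps ref)/(saturated_class eqv_eps ref).
have mC : measurable (C : set limit_space).
  by apply: sub_sigma_algebra; exists n.
have C0 : (0 < mu C)%E.
  by apply: (mu_gt0 lC); exists x; exact: (partition_refl eqv_eps ref).
have Cfin : mu C \is a fin_num by exact: fin_num_measure.
have m0 : 0 < fine (mu C) by rewrite fine_gt0// C0 ltey_eq Cfin.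
have YE z : Y z = (fine (Y z))%:E by rewrite fineK// in01_fin_num.
have Y0 z : 0 <= fine (Y z) by have /fine_in01/andP[] := Y01 z.
have I_le : (\int[mu]_(z in C) Y z <= ((c + e) * fine (mu C))%:E)%E.
  rewrite EFinM fineK// -integral_cst//.
  apply: le_integral_nonneg => z Cz; first by case/andP: (Y01 z).
  by rewrite YE lee_fin; have := Yce z Cz; rewrite ler_distlC; lra.
have I_ge : (((c - e) * fine (mu C))%:E <= \int[mu]_(z in C) Y z)%E.
  (* The constant c - e may be negative; truncating it at 0 keeps the integrand nonnegative and
     still below Y. *)
  apply: (@le_trans _ _ (Num.max 0 (c - e) * fine (mu C))%:E).
    by rewrite lee_fin ler_pM2r// le_max lexx orbT.
  rewrite EFinM fineK// -integral_cst//.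
  apply: le_integral_nonneg => z Cz; first by rewrite lee_fin le_max lexx.
  rewrite YE lee_fin ge_max Y0/=.
  by have := Yce z Cz; rewrite ler_distlC; lra.
have I_fin : (\int[mu]_(z in C) Y z)%E \is a fin_num.
  by rewrite fin_real// (lt_le_trans _ I_ge) ?ltNyr// (le_lt_trans I_le) ?ltry.
rewrite /class_expectation -/C fineM//= ler_distl.
move: I_le I_ge; rewrite -(fineK I_fin) !lee_fin /= => I_le I_ge.
by rewrite mulrC ler_pdivlMr// ler_pdivrMr// I_ge.
Qed.

Variable out : nat -> target_problem R T.
Hypothesis outE : forall n x F, level_sigma (T := T) pi n F ->
  out n x F = class_expectation mu (fun z => tp z F) n x.

Lemma output_dist_eps n x (G : set X) : saturated (pi n) G ->
  `|fine (out n.+1 x G) - fine (tp x G)| <= eps n.+1.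
Proof.
move=> sG; have mG := measurable_saturated eqv_eps ref sG.
(* [P_(n+1)] is defined on the sigma-algebra of level n + 1, which contains the n-saturated sets
   since they are also (n + 1)-saturated. *)
rewrite outE; last first.
  apply: (level_sigma_saturated eqv_eps ref).
  exact: (saturated_le ref (leqnSn n)).
apply: class_expectation_dist.
  by move=> z; apply: measure_in01 => //; exact: prob_kernel.
by move=> z xz; rewrite distrC; exact: kernel_dist_eps.
Qed.

End closeness.

(** * Uniform approximation by means of indicators *)

Section step_approximation.
Context {R : realType}.

(** The sum counts the integers from 1 to M that are at most t. Together with the lower bound below,
    this makes it a rounding of t with error at most 1 when 0 <= t <= M. *)
Lemma sum_le_threshold (M : nat) (t : R) :
  0 <= t -> \sum_(j < M) (j.+1%:R <= t)%R%:R <= t.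
Proof.
move=> t0; elim: M => [|M IH]; first by rewrite big_ord0.
have [Mt|tM] := leP M.+1%:R t; last first.
  by rewrite big_ord_recr/= (lt_geF tM) addr0.
apply: le_trans Mt; rewrite -[leRHS]mulr1.
rewrite mulr_natl -[X in _ *+ X]card_ord -sumr_const.
by apply: ler_sum => j _; rewrite lern1 leq_b1.
Qed.

Lemma sum_ge_threshold (M : nat) (t : R) :
  t <= M%:R -> t - 1 <= \sum_(j < M) (j.+1%:R <= t)%R%:R.
Proof.
elim: M => [t0|M IH tM]; first by rewrite big_ord0; lra.
have [tM'|Mt] := leP t M%:R.
  by rewrite big_ord_recr/= (le_trans (IH tM'))// lerDl.
rewrite big_ord_recr/= (eq_bigr (fun=> 1)); last first.
  by move=> j _; rewrite (le_trans _ (ltW Mt))// ler_nat.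
rewrite sumr_const card_ord; apply: (@le_trans _ _ M%:R).
  by rewrite lerBlDr natr1.
by rewrite lerDl.
Qed.

Lemma step_approximation {X : Type} (r : X -> X -> Prop) (f : X -> R) (e : R)
    (N : nat) :
  (forall x, r x x) -> (forall x y, r x y -> r y x) ->
  (forall x y z, r x y -> r y z -> r x z) ->
  (forall x, 0 <= f x <= 1) -> (forall x y, r x y -> `|f x - f y| <= e) ->
  exists G : nat -> set X, (forall j, saturated r (G j)) /\
    forall x, `|f x - N.+1%:R^-1 * \sum_(j < N.+1) \1_(G j) x|
      <= e + N.+1%:R^-1.
Proof.
move=> rr rs rt f01 fe.
(* Each set is the r-saturation of the superlevel set of f at height (j + 1) / (N + 1). Saturating
   lets in only points where f is at most e below that height; rounding to the grid costs 1 / (N +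
   1). *)
exists (fun j => [set x | exists2 y, r x y & j.+1%:R <= N.+1%:R * f y]).
split=> [j x y xy [z xz zj]|x].
  by exists z => //; apply: rt xz; exact: rs.
have M0 : 0 < N.+1%:R :> R by [].
have e0 : 0 <= e by apply: le_trans (fe _ _ (rr x)).
have /andP[f0 f1] := f01 x.
set s := \sum_(_ < _) _.
have s_le : s <= N.+1%:R * (f x + e).
  apply: le_trans (sum_le_threshold N.+1 _).
    2: by rewrite mulr_ge0// addr_ge0.
  apply: ler_sum => j _; rewrite indicE.
  have [/set_mem[y xy yj]|//] := boolP (_ \in _).
  rewrite (le_trans yj)// ler_pM2l//.
  by have := fe _ _ xy; rewrite ler_distlC; lra.
have s_ge : N.+1%:R * f x - 1 <= s.
  apply: le_trans (sum_ge_threshold (M := N.+1) _) _.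
    by rewrite -[leRHS]mulr1 ler_pM2l.
  apply: ler_sum => j _; rewrite indicE; 
  have [xj|//] := boolP (j.+1%:R <= N.+1%:R * f x).
  by rewrite mem_set//; exists x.
have v0 : 0 < N.+1%:R^-1 :> R by rewrite invr_gt0.
have h1 : N.+1%:R^-1 * s <= f x + e by rewrite ler_pdivrMl.
have h2 : f x - N.+1%:R^-1 <= N.+1%:R^-1 * s.
  by rewrite ler_pdivlMl// mulrBr divff ?gt_eqF.
move: v0 h1 h2; move: (N.+1%:R^-1 * s) (N.+1%:R^-1) => w v v0 h1 h2.
by rewrite ler_distl; apply/andP; split; lra.
Qed.

(** The factor 1 / (N + 1) cancels the number of terms, so the error does not grow with the number
    of sets. *)
Lemma mean_dist (N : nat) (a b : nat -> R) (e : R) :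
  (forall j, `|a j - b j| <= e) ->
  `|N.+1%:R^-1 * (\sum_(j < N.+1) a j) - N.+1%:R^-1 * (\sum_(j < N.+1) b j)|
    <= e.
Proof.
move=> abe; rewrite -mulrBr -sumrB normrM gtr0_norm ?invr_gt0//.
rewrite mulrC ler_pdivrMr// mulr_natr -[X in _ *+ X]card_ord -sumr_const.
by apply: le_trans (ler_norm_sum _ _ _) _; apply: ler_sum.
Qed.

End step_approximation.

(** * Bounds and measurability of kernel powers *)

Section kernel_powers.
Context {d : measure_display} {X : measurableType d} {R : realType}.
Variables (F : set (set X)).
Local Notation TX := (g_sigma_algebraType F).
Variable P : R.-pker TX ~> TX.
Variable G : set X.
Hypothesis mG : measurable (G : set TX).

Lemma kernel_power_in01 k x : (0 <= kernel_power P k.+1 x G <= 1)%E.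
Proof.
elim: k x => [|k IH] x; first by apply: measure_in01 => //; exact: prob_kernel.
exact: (integral_in01 (prob_kernel (s := P) x) IH).
Qed.

Lemma measurable_kernel_power k :
  measurable_fun (setT : set TX) (fun x => kernel_power P k.+1 x G).
Proof.
elim: k => [|k IH]; first exact: measurable_kernel.
apply: (measurable_fun_integral_kernel (l := P)) => //.
- by move=> U; exact: measurable_kernel.
- by move=> z; case/andP: (kernel_power_in01 k z).
Qed.

End kernel_powers.

(** * Uniform convergence of the hitting probabilities for a fixed number of steps *)

Section convergence.
Context {d : measure_display} {X : measurableType d} {R : realType}
        {T : set X}.
Variables (tp : target_problem R T) (eps : nat -> R)
  (eqv : nat -> subprob_space R -> subprob_space R -> Prop)
  (pi : nat -> X -> X -> Prop) (A : nat -> nat -> set X)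
  (p : nat -> X -> subprob_seq R)
  (mu : probability
          (g_sigma_algebraType (\bigcup_n level_sigma (T := T) pi n)) R)
  (out : nat -> target_problem R T).
Hypothesis eps_cvg : eps n @[n --> \oo] --> 0.
Hypothesis eqv_eps : forall n, (0 < n)%N -> eps_equivalence (eps n) (eqv n).
Hypothesis ref : refinement eqv tp pi A p.
Hypothesis mu_gt0 : forall n F,
  level_sigma (T := T) pi n F -> F !=set0 -> (0 < mu F)%E.
Hypothesis out_sigma : forall n, tp_sigma (out n) = level_sigma (T := T) pi n.
Hypothesis outE : forall n x F, level_sigma (T := T) pi n F ->
  out n x F = class_expectation mu (fun z => tp z F) n x.

(** The real-valued probability of being in T after k + 1 steps; the shift reflects that kernel
    powers start at 1. *)
Local Notation hit P k x := (fine (kernel_power P k.+1 x T)).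

Lemma measurable_target (tq : target_problem R T) :
  measurable (T : set (g_sigma_algebraType (tp_sigma tq))).
Proof. by apply: sub_sigma_algebra; exact: tp_target. Qed.

Lemma hit_in01 (tq : target_problem R T) k x : 0 <= hit tq k x <= 1.
Proof. exact/fine_in01/(kernel_power_in01 tq (@measurable_target tq)). Qed.

Lemma eps_small (e : R) : 0 < e ->
  exists n0, forall n, (n0 <= n)%N -> eps n <= e.
Proof.
move=> e0; have /cvgrPdist_le /(_ _ e0) [n0 _ n0P] := eps_cvg.
exists n0 => n /n0P /=; rewrite sub0r normrN; apply: le_trans; exact: ler_norm.
Qed.

Lemma inv_small (e : R) : 0 < e -> exists N, N.+1%:R^-1 <= e.
Proof.
move=> e0; have /cvgrPdist_le /(_ _ e0) [N _ /(_ N)] := @cvg_harmonic R.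
move=> /(_ (leqnn _)) /=; rewrite sub0r normrN => h; exists N.
exact: le_trans (ler_norm _) h.
Qed.

Definition oscillation_vanishes k := forall e, 0 < e ->
  exists m, forall x y, pi m x y -> `|hit tp k x - hit tp k y| <= e.

Lemma hit_step k (e : R) : oscillation_vanishes k -> 0 < e ->
  exists m N (G : nat -> set X), (forall j, saturated (pi m) (G j)) /\
    forall x, `|hit tp k x - N.+1%:R^-1 * \sum_(j < N.+1) \1_(G j) x| <= e.
Proof.
move=> osc e0; have e2 : 0 < e / 2 by lra.
have [m mP] := osc _ e2; have [N NP] := inv_small e2.
have [G [sG GP]] := step_approximation N (partition_refl eqv_eps ref m)
  (@partition_sym _ _ _ _ _ _ _ _ _ _ eqv_eps ref m)
  (@partition_trans _ _ _ _ _ _ _ _ _ _ eqv_eps ref m) (hit_in01 tp k) mP.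
exists m, N, G; split=> // x; apply: le_trans (GP x) _.
by rewrite [leRHS](splitr e) lerD2l.
Qed.

(** One more step integrates against the kernel at x, which turns each indicator into the kernel
    mass of its set. An arbitrary [tq] is allowed so that the bound serves both [tp] and [out n]. *)
Lemma integral_hit_step (tq : target_problem R T) k x N (G : nat -> set X) e :
  (forall j, measurable (G j : set (g_sigma_algebraType (tp_sigma tq)))) ->
  (forall x,
    `|hit tq k x - N.+1%:R^-1 * \sum_(j < N.+1) \1_(G j) x| <= e) ->
  `|hit tq k.+1 x - N.+1%:R^-1 * \sum_(j < N.+1) fine (tq x (G j))| <= e.
Proof.
move=> mG Ge.
apply: (integral_step_dist (prob_kernel (s := tq) x)) => //.
- exact: (measurable_kernel_power tq (@measurable_target tq)).
- exact: (kernel_power_in01 tq (@measurable_target tq)).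
Qed.

Lemma hit_oscillation k : oscillation_vanishes k.
Proof.
elim: k => [|k IH] e e0.
  have [n0 n0P] := eps_small e0; exists n0.+1 => x y xy.
  apply: le_trans (n0P n0.+1 (leqnSn _)).
  exact: (kernel_dist_eps eqv_eps ref xy (saturated_target (n := n0) ref)).
have e4 : 0 < e / 4 by lra.
have [m [N [G [sG GP]]]] := hit_step IH e4.
have [n0 n0P] := eps_small e4.
(* At level [maxn m n0] the sets G_j are saturated, and one level more makes their kernel masses at
   x and y comparable. The total error is three times e / 4. *)
exists (maxn m n0).+1 => x y xy.
have mG j := measurable_saturated eqv_eps ref (sG j).
have Ix := integral_hit_step x mG GP.
have Iy := integral_hit_step y mG GP.
have Gxy : `|N.+1%:R^-1 * (\sum_(j < N.+1) fine (tp x (G j))) -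
             N.+1%:R^-1 * (\sum_(j < N.+1) fine (tp y (G j)))| <= e / 4.
  apply: (@mean_dist _ N (fun j => fine (tp x (G j)))
    (fun j => fine (tp y (G j)))) => j.
  apply: le_trans (n0P (maxn m n0).+1 _); last by rewrite leqW// leq_maxr.
  apply: (kernel_dist_eps eqv_eps ref xy).
  exact: (saturated_le ref (leq_maxl _ _)).
move: Ix Iy Gxy; move: (N.+1%:R^-1 * _) (N.+1%:R^-1 * _) => u v.
by rewrite !ler_distl; lra.
Qed.

Lemma hit_converges k (e : R) : 0 < e -> exists n0, forall n, (n0 <= n)%N ->
  forall x, `|hit (out n) k x - hit tp k x| <= e.
Proof.
elim: k e => [|k IH] e e0.
  have [n0 n0P] := eps_small e0; exists n0.+1 => -[//|n] n0n x.
  apply: le_trans (n0P n.+1 (leqW n0n)).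
  apply: (output_dist_eps eqv_eps ref mu_gt0 outE).
  exact: (saturated_target ref).
have e4 : 0 < e / 4 by lra.
have [m [N [G [sG GP]]]] := hit_step (hit_oscillation k) e4.
have [n0 n0P] := eps_small e4.
have [n1 n1P] := IH _ e4.
(* The outputs are controlled from index 1 on, with [P_(n+1)] tested on n-saturated sets; hence the
   shift. *)
exists (maxn m (maxn n0 n1)).+1 => -[//|n]; rewrite ltnS !geq_max.
move=> /and3P[mn n0n n1n] x.
have sGn j : saturated (pi n) (G j) by exact: (saturated_le ref mn).
have mG j := measurable_saturated eqv_eps ref (sG j).
have mG' j :
    measurable (G j : set (g_sigma_algebraType (tp_sigma (out n.+1)))).
  apply: sub_sigma_algebra; rewrite out_sigma.
  apply: (level_sigma_saturated eqv_eps ref).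
  exact: (saturated_le ref (leqnSn n)).
have Ix := integral_hit_step x mG GP.
(* The same sets G_j approximate the powers of the output kernel: e / 4 from the step function and e
   / 4 from the induction hypothesis. The final budget is e / 4 + e / 2 + e / 4. *)
have GP' y : `|hit (out n.+1) k y - N.+1%:R^-1 * \sum_(j < N.+1) \1_(G j) y|
    <= e / 2.
  have := n1P n.+1 (leqW n1n) y; have := GP y.
  move: (N.+1%:R^-1 * _) => u.
  by rewrite !ler_distl; lra.
have Iy := integral_hit_step x mG' GP'.
have Gxy : `|N.+1%:R^-1 * (\sum_(j < N.+1) fine (out n.+1 x (G j))) -
             N.+1%:R^-1 * (\sum_(j < N.+1) fine (tp x (G j)))| <= e / 4.
  apply: (@mean_dist _ N (fun j => fine (out n.+1 x (G j)))
    (fun j => fine (tp x (G j)))) => j.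
  apply: le_trans (n0P n.+1 (leqW n0n)).
  exact: (output_dist_eps eqv_eps ref mu_gt0 outE).
move: Ix Iy Gxy; move: (N.+1%:R^-1 * _) (N.+1%:R^-1 * _) => u v.
by rewrite !ler_distl; lra.
Qed.

End convergence.

(** * Summation over the number of steps with geometric weights *)

Lemma geometric_weighted_sum_le {R : realType} (beta delta : R) (K m : nat)
    (c : nat -> R) :
  0 < beta < 1 -> 0 <= delta -> (forall k, (k < K)%N -> c k <= delta) ->
  (forall k, c k <= 1) ->
  \sum_(0 <= k < m) beta ^+ k * c k <= (delta + beta ^+ K) / (1 - beta).
Proof.
move=> /andP[b0 b1] delta0 cK c1; rewrite ler_pdivlMr ?subr_gt0//.
(* The left side is a potential, equal to the right side at m = 0 and nonincreasing in m. A new term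
   is paid for by the drop of [delta * beta ^+ m] while m < K, and by the drop of [beta ^+ maxn m K]
   afterwards. *)
suff : (\sum_(0 <= k < m) beta ^+ k * c k) * (1 - beta) + delta * beta ^+ m
    + beta ^+ maxn m K <= delta + beta ^+ K.
  have bm n : 0 <= beta ^+ n by rewrite exprn_ge0// ltW.
  by have := mulr_ge0 delta0 (bm m); have := bm (maxn m K); lra.
elim: m => [|m IH]; first by rewrite big_nil mul0r max0n expr0 mulr1 add0r.
apply: le_trans IH; rewrite big_nat_recr//= mulrDl exprS.
have bm : 0 <= beta ^+ m by rewrite exprn_ge0// ltW.
have b1' : 0 <= 1 - beta by rewrite subr_ge0 ltW.
have bb := mulr_ge0 bm b1'.
have [mK|Km] := ltnP m K.
  by rewrite (maxn_idPr mK); have := ler_wpM2l bb (cK _ mK); nra.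
rewrite (maxn_idPl (leqW Km)) exprS.
by have := ler_wpM2l bb (c1 m); have := mulr_ge0 bb delta0; nra.
Qed.

Lemma cvge0_le {R : realType} (u : nat -> \bar R) :
  (forall e : R, 0 < e -> exists n0, forall n, (n0 <= n)%N ->
    (0 <= u n <= e%:E)%E) ->
  u n @[n --> \oo] --> 0%E.
Proof.
move=> ue; apply/fine_cvgP; split.
  have [n0 n0P] := ue 1 ltr01; exists n0 => // n /n0P /andP[u0 u1].
  by rewrite ge0_fin_numE// (le_lt_trans u1)// ltry.
apply/cvgrPdist_le => e /ue [n0 n0P]; exists n0 => // n /n0P /andP[u0 u1] /=.
have ufin : u n \is a fin_num by rewrite ge0_fin_numE// (le_lt_trans u1)// ltry.
by rewrite sub0r normrN ger0_norm ?fine_ge0// -lee_fin fineK.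
Qed.

Theorem theorem1 (d : measure_display) (X : measurableType d) (R : realType)
    (A0 : assumption_A0 X R) (T : set X) (mT : measurable T)
    (beta : R) (beta01 : 0 < beta < 1)
    (Str : strategy R T) (algStr : target_algorithm Str)
    (tp : target_problem R T) :
  kernel_dist T beta tp (Str n tp) @[n --> \oo] --> 0%E.
Proof.
have [eps [eqv [_ eps_cvg eqv_eps /(_ tp)]]] := algStr.
move=> [pi [A [p [mu [ref mu_gt0 out_sigma outE]]]]].
have hit_cvg := hit_converges eps_cvg eqv_eps ref mu_gt0 out_sigma outE.
(* Convergence holds for each k separately; the maximum of finitely many thresholds serves all k < K
   at once. *)
have hit_cvg_below K e : 0 < e -> exists n0, forall n, (n0 <= n)%N ->
    forall k, (k < K)%N -> forall x,
    `|fine (kernel_power (Str n tp) k.+1 x T) -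
      fine (kernel_power tp k.+1 x T)| <= e.
  move=> e0; elim: K => [|K [n0 n0P]]; first by exists 0%N.
  have [n1 n1P] := hit_cvg K _ e0.
  exists (maxn n0 n1) => n; rewrite geq_max => /andP[n0n n1n] k.
  by rewrite ltnS leq_eqVlt => /predU1P[->|]; [exact: n1P|exact: n0P].
have /andP[b0 b1] := beta01.
apply: cvge0_le => e e0.
(* This value bounds both the error below K and [beta ^+ K]; the two together, divided by 1 - beta,
   give e. *)
have e'0 : 0 < e * (1 - beta) / 2 by rewrite divr_gt0// mulr_gt0// subr_gt0.
have [K KP] : exists K, beta ^+ K <= e * (1 - beta) / 2.
  have /cvg_expr/cvgrPdist_le/(_ _ e'0) [K _ /(_ K (leqnn _))] : `|beta| < 1.
    by rewrite gtr0_norm.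
  by rewrite /= sub0r normrN => h; exists K; exact: le_trans (ler_norm _) h.
have [n0 n0P] := hit_cvg_below K _ e'0.
exists n0 => n n0n.
pose h x k := `|fine (kernel_power (Str n tp) k.+1 x T) -
                fine (kernel_power tp k.+1 x T)|.
have h01 (tq : target_problem R T) k x :
    0 <= fine (kernel_power tq k.+1 x T) <= 1.
  exact: hit_in01.
have termE x k : ((beta ^+ k.+1)%:E *
    `|kernel_power tp k.+1 x T - kernel_power (Str n tp) k.+1 x T| =
    (beta ^+ k.+1 * h x k)%:E)%E.
  rewrite /h distrC EFinM; congr (_ * _)%E.
  have fin (tq : target_problem R T) : kernel_power tq k.+1 x T \is a fin_num.
    exact/in01_fin_num/(kernel_power_in01 tq (@measurable_target _ _ _ _ tq)).
  by rewrite -[in LHS](fineK (fin tp)) -[in LHS](fineK (fin (Str n tp))).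
have h_le1 x k : h x k <= 1.
  by have := h01 tp k x; have := h01 (Str n tp) k x; rewrite ler_norml; lra.
have sum_le x m : \sum_(0 <= k < m) beta ^+ k.+1 * h x k <= e.
  (* One factor [beta <= 1] is dropped to match the weights of the geometric bound. *)
  apply: (@le_trans _ _ (\sum_(0 <= k < m) beta ^+ k * h x k)).
    apply: ler_sum => k _; apply: ler_wpM2r; first exact: normr_ge0.
    by rewrite exprS ler_piMl ?exprn_ge0// ltW.
  have hK k : (k < K)%N -> h x k <= e * (1 - beta) / 2.
    by move=> kK; exact: n0P.
  apply: (le_trans (geometric_weighted_sum_le m beta01 (ltW e'0) hK (h_le1 x))).
  rewrite ler_pdivrMr ?subr_gt0//; lra.
have term_ge0 x k : (0 <= (beta ^+ k)%:E *
    `|kernel_power tp k x T - kernel_power (Str n tp) k x T|)%E.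
  by rewrite mule_ge0// lee_fin exprn_ge0// ltW.
apply/andP; split.
  (* The supremum dominates the nonnegative series at [point]. *)
  apply: le_trans (ereal_sup_ubound _); last by exists point.
  exact: nneseries_ge0.
apply: ge_ereal_sup => _ [x _ <-].
(* The partial sums are bounded by e uniformly in x and m, so the series and then the supremum are
   too. *)
apply: lime_le; first exact: is_cvg_nneseries.
apply: nearW => m; rewrite big_add1.
by under eq_bigr do rewrite termE; rewrite sumEFin lee_fin.
Qed.
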